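(* Let $\mathscr{C}=\{(\boldsymbol{u}(i),\mathcal{D}_i)\}_{i=1}^M$ be a code from the family $\mathsf{C}(C,\boldsymbol{A},\boldsymbol{L},\boldsymbol{\alpha},\boldsymbol{p},\boldsymbol{r})$ described below. Then $\mathscr{C}$ is an $(n,M,\mathcal{X},\epsilon,B,\delta)$-code for the complex AWGN channel with noise variance $\sigma^2$ if the following inequalities are simultaneously satisfied: \[ \epsilon\ge 1-\frac1M\sum_{i=1}^M\prod_{c=1}^C\left(1-\exp\!\left(-\frac{r_c^2}{\sigma^2}\right)\right)^{n\sum_{\ell=1}^{L_c}P_{\boldsymbol{u}(i)}(x_c^{(\ell)})}, \] \[ R(\mathscr{C})\le\log_2\left(\sum_{c=1}^C\left\lfloor\frac{\pi}{2\arcsin\frac{r_c}{2A_c}}\right\rfloor\right), \] \[ \delta\ge\frac1M\sum_{i=1}^M\mathbb{1}_{\left\{\sum_{c=1}^C\sum_{\ell=1}^{L_c}P_{\boldsymbol{u}(i)}(x_c^{(\ell)})(k_1A_c^2+k_2A_c^4)<\frac{B}{n}\right\}}, \] \[ B\le\bar e_{j^{+}}, \] where $\bar e_1<\dots<\bar e_{M'}$ are the distinct values among $e_1,\dots,e_M$ and $j^{+}=\min\{j\in\{1,\dots,M'\}:\ \delta\le\frac1M\sum_{k=1}^j\sum_{i=1}^M\mathbb{1}_{\{e_i=\bar e_k\}}\}$.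
   Context: Channel: $f_{\boldsymbol{Y}|\boldsymbol{X}}(\boldsymbol{y}|\boldsymbol{\nu})=\prod_{m=1}^n \frac{1}{\pi\sigma^2}\exp(-|y_m-\nu_m|^2/\sigma^2)$. An $(n,M,\mathcal{X})$-code is $\{(\boldsymbol{u}(i),\mathcal{D}_i)\}_{i=1}^M$ with $\boldsymbol{u}(i)\in\mathcal{X}^n$ and pairwise disjoint $\mathcal{D}_i\subseteq\mathbb{C}^n$; $R(\mathscr{C})=\frac{\log_2M}{n}$; $\gamma(\mathscr{C})=\frac1M\sum_i\big(1-\int_{\mathcal{D}_i}f_{\boldsymbol{Y}|\boldsymbol{X}}(\boldsymbol{y}|\boldsymbol{u}(i))\mathrm{d}\boldsymbol{y}\big)$; $e_i=k_1\sum_m|u_m(i)|^2+k_2\sum_m|u_m(i)|^4$ with positive constants $k_1,k_2$; $\theta(\mathscr{C},B)=\frac1M\sum_i\mathbb{1}_{\{e_i<B\}}$; an $(n,M,\mathcal{X},\epsilon,B,\delta)$-code is one with $\gamma(\mathscr{C})\le\epsilon$, $\theta(\mathscr{C},B)\le\delta$. Types: $P_{\boldsymbol{u}(i)}(x)=\frac1n\sum_m\mathbb{1}_{\{u_m(i)=x\}}$, $P_{\mathscr{C}}=\frac1M\sum_iP_{\boldsymbol{u}(i)}$. Family $\mathsf{C}(C,\boldsymbol{A},\boldsymbol{L},\boldsymbol{\alpha},\boldsymbol{p},\boldsymbol{r})$: $C\in\mathbb{N}$ layers; amplitudes $A_1>A_2>\dots>A_C>0$; $L_c\in\mathbb{N}$;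 phases $\alpha_c\in[0,2\pi]$; layer $c$ is $\mathcal{U}(A_c,L_c,\alpha_c)=\{x_c^{(1)},\dots,x_c^{(L_c)}\}=\{A_c\exp(\mathrm{i}(2\pi\ell/L_c+\alpha_c)):\ell=0,\dots,L_c-1\}$, and $\mathcal{X}=\bigcup_{c=1}^C\mathcal{U}(A_c,L_c,\alpha_c)$. The codewords are pairwise distinct elements of $\mathcal{X}^n$ with $P_{\mathscr{C}}(x_c^{(\ell)})=p_c/L_c$ for all $c,\ell$, where $\boldsymbol{p}=(p_1,\dots,p_C)$ is a probability vector. With radii $r_c>0$, let $\mathcal{G}_c^{(\ell)}=\{y\in\mathbb{C}:|y-x_c^{(\ell)}|\le r_c\}$; the decoding set of $\boldsymbol{u}(i)$ is $\mathcal{D}_i=\mathcal{D}_{i,1}\times\dots\times\mathcal{D}_{i,n}$ with $\mathcal{D}_{i,m}=\mathcal{G}_c^{(\ell)}$ where $u_m(i)=x_c^{(\ell)}$; and $A_c-A_{c+1}\ge r_c+r_{c+1}$ for $c=1,\dots,C-1$. *)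

(* Defs.v *)
(* Complex numbers are represented as
   pairs (Re, Im) in R * R; Lebesgue measure on C = R^2 is the product
   measure lebesgue \x lebesgue. *)
From HB Require Import structures.
From mathcomp Require Import all_boot all_order all_algebra.
From mathcomp Require Import all_classical all_reals all_analysis.
Set Implicit Arguments. Unset Strict Implicit. Unset Printing Implicit Defensive.
Import Order.TTheory GRing.Theory Num.Theory.
Import numFieldNormedType.Exports.
Local Open Scope classical_set_scope.
Local Open Scope ring_scope.

Section defs.
Variable R : realType.

Definition apsk_sqmod (z : R * R) : R := z.1 ^+ 2 + z.2 ^+ 2.
Definition apsk_cdist (y x : R * R) : R := Num.sqrt (apsk_sqmod (y.1 - x.1, y.2 - x.2)).

Definition apsk_lebC := ((@lebesgue_measure R) \x (@lebesgue_measure R))%E.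

(* Iterated Lebesgue integral over the coordinates 0 .. k-1 (Tonelli) *)
Fixpoint apsk_iter_intC (k : nat) (F : (nat -> R * R) -> \bar R)
    : (nat -> R * R) -> \bar R :=
  match k with
  | 0 => F
  | k'.+1 => fun g => (\int[apsk_lebC]_(y in setT)
                        apsk_iter_intC k' F (fun m => if m == k' then y else g m))%E
  end.

(* Lebesgue integral over C^n of a nonnegative function F *)
Definition apsk_intCn (n : nat) (F : ('I_n -> R * R) -> \bar R) : \bar R :=
  apsk_iter_intC n (fun g => F (fun m => g (nat_of_ord m))) (fun _ => (0, 0)).

Definition apsk_awgn_density (sigma : R) (n : nat) (nu y : 'I_n -> R * R) : R :=
  \prod_(m < n) ((pi * sigma ^+ 2)^-1 *
                 expR (- apsk_sqmod ((y m).1 - (nu m).1, (y m).2 - (nu m).2) / sigma ^+ 2)).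

Definition apsk_err_prob (sigma : R) (n M : nat) (u : 'I_M -> 'I_n -> R * R)
    (D : 'I_M -> set ('I_n -> R * R)) : \bar R :=
  ((M%:R^-1)%:E * \sum_(i < M)
     (1 - apsk_intCn (fun y => (\1_(D i) y * apsk_awgn_density sigma (u i) y)%:E)))%E.

Definition apsk_energy (k1 k2 : R) (n : nat) (w : 'I_n -> R * R) : R :=
  k1 * \sum_(m < n) apsk_sqmod (w m) + k2 * \sum_(m < n) (apsk_sqmod (w m)) ^+ 2.

Definition apsk_theta (k1 k2 : R) (n M : nat) (u : 'I_M -> 'I_n -> R * R) (B : R) : R :=
  M%:R^-1 * \sum_(i < M) ((apsk_energy k1 k2 (u i) < B)%R : bool)%:R.

Definition apsk_wtype (n : nat) (w : 'I_n -> R * R) (x : R * R) : R :=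
  n%:R^-1 * \sum_(m < n) (w m == x)%:R.

Definition apsk_code_type (n M : nat) (u : 'I_M -> 'I_n -> R * R) (x : R * R) : R :=
  M%:R^-1 * \sum_(i < M) apsk_wtype (u i) x.

(* the constellation point x_c^(l) = A_c exp(i(2 pi l / L_c + alpha_c)),
   layers c = 0..C-1 (paper: 1..C), l = 0..L_c-1 *)
Definition apsk_cpoint (A : nat -> R) (L : nat -> nat) (alpha : nat -> R)
    (c l : nat) : R * R :=
  (A c * cos (2 * pi * l%:R / (L c)%:R + alpha c),
   A c * sin (2 * pi * l%:R / (L c)%:R + alpha c)).

Definition apsk_in_constellation (C : nat) (A : nat -> R) (L : nat -> nat)
    (alpha : nat -> R) (x : R * R) : Prop :=
  exists c l, (c < C)%N /\ (l < L c)%N /\ x = apsk_cpoint A L alpha c l.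

(* decoding set D_i = product of the disks G_c^(l) around the symbols of w *)
Definition apsk_dec_set (C : nat) (A : nat -> R) (L : nat -> nat) (alpha : nat -> R)
    (r : nat -> R) (n : nat) (w : 'I_n -> R * R) : set ('I_n -> R * R) :=
  [set y | forall (m : 'I_n) (c l : nat), (c < C)%N -> (l < L c)%N ->
      w m = apsk_cpoint A L alpha c l -> apsk_cdist (y m) (apsk_cpoint A L alpha c l) <= r c].

Definition apsk_log2 (x : R) : R := ln x / ln 2.

End defs.

(* Main.v *)
(* A symbol in layer c is decoded within a disk of radius r_c around itself, and the complex Gaussian mass of
   that disk is 1 - e^(-r_c^2/sigma^2). The mass is obtained without polar coordinates: the area of a disk is
   computed by slicing, and the disk is cut into annuli of equal area on which the density is nearly constant.
   Tonelli turns the success probability of a codeword into the product of these masses over its symbols, and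
   since the constellation points are pairwise distinct, grouping the symbols by layer turns product and energy
   into the expressions in terms of types. *)
Require Import Defs.
From HB Require Import structures.
From mathcomp Require Import all_boot all_order all_algebra.
From mathcomp Require Import ring lra.
From mathcomp Require Import all_classical all_reals all_analysis.
From mathcomp Require Import measurable_realfun.
Import Order.TTheory GRing.Theory Num.Theory.
Import numFieldNormedType.Exports.
Local Open Scope classical_set_scope.
Local Open Scope ring_scope.

(** * Area of a disk in the plane *)

Section disk.
Variable R : realType.
Implicit Types a s t h rho : R.
Local Notation mu := (@lebesgue_measure R).

(** The substitution [x = a + rho * sin th] turns the integrand into [2 rho^2 cos^2 th] on
    [[-pi/2, pi/2]], with primitive [H]. *)
Lemma integral_semicircle a rho : 0 < rho ->
  (\int[mu]_(x in `[(a - rho)%R, (a + rho)%R])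
     (2 * Num.sqrt (rho ^+ 2 - (x - a) ^+ 2))%R%:E = (pi * rho ^+ 2)%R%:E)%E.
Proof.
move=> rho0; have pi0 := pi_gt0 R.
pose F (th : R) : R := a + rho * sin th.
pose G (x : R) : R := 2 * Num.sqrt (rho ^+ 2 - (x - a) ^+ 2).
have dF (th : R) : is_derive th 1 F (rho * cos th).
  by rewrite /F; apply: is_derive_eq; rewrite /GRing.scale/=; ring.
have F'E : (derive1 F) = fun th => rho * cos th.
  by apply/funext => th; rewrite derive1E; exact: derive_val.
have cF : continuous F.
  by move=> th; apply/differentiable_continuous/derivable1_diffP; exact: ex_derive.
have cF' : continuous (derive1 F).
  by rewrite F'E => th; apply: cvgM; [exact: cvg_cst|exact: continuous_cos].
have cG : continuous G.
  move=> x; apply: cvgM; first exact: cvg_cst.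
  apply: (@continuous_comp _ _ _ (fun x => rho ^+ 2 - (x - a) ^+ 2) Num.sqrt);
    last exact: sqrt_continuous.
  apply: cvgB; first exact: cvg_cst.
  rewrite expr2; under eq_fun do rewrite expr2.
  by apply: cvgM; apply: cvgB; [exact: cvg_id|exact: cvg_cst|exact: cvg_id|exact: cvg_cst].
have -> : a - rho = F (- (pi / 2)) by rewrite /F sinN sin_pihalf; ring.
have -> : a + rho = F (pi / 2) by rewrite /F sin_pihalf; ring.
rewrite (@integration_by_substitution_increasing _ F G); last 7 first.
- lra.
- by move=> y z yI zI yz; rewrite /F ltrD2l ltr_pM2l// ltr_sin.
- by move=> y _; exact: cF'.
- by apply/cvg_ex; exists ((derive1 F) (- (pi / 2))); apply: cvg_at_right_filter; exact: cF'.
- by apply/cvg_ex; exists ((derive1 F) (pi / 2)); apply: cvg_at_left_filter; exact: cF'.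
- split; [by move=> y _; exact: ex_derive|by apply: cvg_at_right_filter; exact: cF|].
  by apply: cvg_at_left_filter; exact: cF.
- exact: continuous_subspaceT.
pose H (th : R) : R := rho ^+ 2 * (th + sin th * cos th).
have dH (th : R) : is_derive th 1 H (2 * rho ^+ 2 * cos th ^+ 2).
  rewrite /H; apply: is_derive_eq.
  have := cos2Dsin2 th; rewrite /GRing.scale/= => e.
  have -> : sin th * - sin th = cos th ^+ 2 - 1 by rewrite -e; ring.
  by ring.
have cH : continuous H.
  by move=> th; apply/differentiable_continuous/derivable1_diffP; exact: ex_derive.
transitivity (\int[mu]_(th in `[(- (pi / 2))%R, (pi / 2)%R])
    (2 * rho ^+ 2 * cos th ^+ 2)%:E)%E.
  (* The cosine is nonnegative on this interval, so the root of the square of [rho * cos th] needs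
     no absolute value. *)
  apply: eq_integral => th; rewrite inE/= in_itv/= => /cos_ge0_pihalf c0; congr EFin.
  rewrite -[LHS]/(G (F th) * derive1 F th) F'E /G /F.
  have -> : rho ^+ 2 - (a + rho * sin th - a) ^+ 2 = (rho * cos th) ^+ 2.
    by rewrite !exprMn cos2sin2; ring.
  by rewrite sqrtr_sqr ger0_norm ?mulr_ge0// ?(ltW rho0)//; ring.
rewrite (@continuous_FTC2 _ _ H); last 4 first.
- lra.
- apply: continuous_subspaceT => th; apply: cvgM; first exact: cvg_cst.
  by rewrite expr2; under eq_fun do rewrite expr2; apply: cvgM; exact: continuous_cos.
- split; [by move=> y _; exact: ex_derive|by apply: cvg_at_right_filter; exact: cH|].
  by apply: cvg_at_left_filter; exact: cH.
- by move=> y _; rewrite derive1E; exact: derive_val.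
by rewrite -EFinB /H sinN cosN sin_pihalf cos_pihalf; congr EFin; field.
Qed.

(* t is the square of the radius, so that the area is linear in t. *)
Definition disk (x : R * R) t : set (R * R) :=
  [set y | apsk_sqmod (y.1 - x.1, y.2 - x.2) <= t].

Lemma measurable_sqmod_sub (x : R * R) :
  measurable_fun setT (fun y : R * R => apsk_sqmod (y.1 - x.1, y.2 - x.2)).
Proof.
rewrite /apsk_sqmod/=; apply: measurable_funD; apply: measurable_funX;
  by apply: measurable_funB.
Qed.

Lemma measurable_disk x t : measurable (disk x t).
Proof.
rewrite /disk -[X in measurable X]setTI.
have := measurable_sqmod_sub x measurableT _ (measurable_itv `]-oo, t]).
by congr measurable; apply/seteqP; split=> y /=; rewrite in_itv/=.
Qed.

(** A slice is an interval or empty; the formula covers the empty one because [Num.sqrt] vanishes on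
    negative reals. *)
Lemma lebesgue_xsection_disk (x : R * R) t z :
  mu (xsection (disk x t) z) = (2 * Num.sqrt (t - (z - x.1) ^+ 2))%:E.
Proof.
have [h|h] := leP 0 (t - (z - x.1) ^+ 2); last first.
  rewrite ltr0_sqrtr// mulr0 (_ : xsection _ _ = set0) ?measure0//.
  rewrite -subset0 => y; rewrite /xsection/= inE /disk /apsk_sqmod/= => le.
  by have := sqr_ge0 (y - x.2); lra.
set s := Num.sqrt _.
rewrite (_ : xsection _ _ = [set` `[x.2 - s, x.2 + s]]); last first.
  apply/seteqP; split => y; rewrite /xsection/= inE /disk /apsk_sqmod/= in_itv/=.
    move=> le; have : (y - x.2) ^+ 2 <= t - (z - x.1) ^+ 2 by lra.
    by rewrite -ler_sqrt// sqrtr_sqr ler_norml -/s => /andP[? ?]; apply/andP; split; lra.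
  move=> /andP[? ?]; have : `|y - x.2| <= s by rewrite ler_norml; apply/andP; split; lra.
  rewrite -[`|_|]sqrtr_sqr ler_sqrt//; lra.
rewrite lebesgue_measure_itv/= lte_fin.
have s0 : 0 <= s := sqrtr_ge0 _.
case: ifPn => [_|]; first by rewrite -EFinB; congr EFin; ring.
by rewrite -leNgt => ?; congr EFin; lra.
Qed.

Lemma lebesgue_disk x t : 0 <= t -> @apsk_lebC R (disk x t) = (pi * t)%:E.
Proof.
move=> t0; rewrite /apsk_lebC /product_measure1.
pose rho : R := Num.sqrt t; have rho_ge0 : 0 <= rho := sqrtr_ge0 _.
have rho2 : rho ^+ 2 = t by rewrite sqr_sqrtr.
pose I := [set` `[x.1 - rho, x.1 + rho]].
have outI (z : R) : ~ I z -> t - (z - x.1) ^+ 2 <= 0.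
  move=> zI; rewrite subr_le0 leNgt; apply/negP => lt; apply: zI.
  have : `|z - x.1| <= rho by rewrite -[`|_|]sqrtr_sqr ler_sqrt// ltW.
  by rewrite ler_norml /I/= in_itv/= => /andP[? ?]; apply/andP; split; lra.
(* Slices off [I] have measure zero, so the integral over the line shrinks to [I]. *)
transitivity (\int[mu]_(z in I) (2 * Num.sqrt (rho ^+ 2 - (z - x.1) ^+ 2))%:E)%E.
  rewrite [RHS]integral_mkcond; apply: eq_integral => z _ /=.
  rewrite lebesgue_xsection_disk rho2 patchE; case: ifPn => // zI.
  by rewrite ler0_sqrtr ?mulr0//; apply: outI => Iz; rewrite mem_set in zI.
have [rho0|] := boolP (0 < rho).
  by rewrite integral_semicircle// rho2.
rewrite lt0r rho_ge0 andbT negbK => /eqP rho0.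
by rewrite -rho2 /I rho0 subr0 addr0 set_itv1 integral_set1 expr0n mulr0.
Qed.

Lemma subset_disk (x : R * R) t t' : t <= t' -> disk x t `<=` disk x t'.
Proof. by move=> tt' y; rewrite /disk/= => /le_trans; exact. Qed.

Lemma lebesgue_annulus (x : R * R) t h : 0 <= t -> 0 <= h ->
  @apsk_lebC R (disk x (t + h) `\` disk x t) = (pi * h)%:E.
Proof.
move=> t0 h0; rewrite /apsk_lebC measureD; last 3 first.
- exact: measurable_disk.
- exact: measurable_disk.
- by rewrite [X in (X < _)%E]lebesgue_disk ?addr_ge0// ltry.
rewrite setIidr; last by apply: subset_disk; rewrite lerDl.
rewrite [X in (X - _)%E]lebesgue_disk ?addr_ge0// [X in (_ - X)%E]lebesgue_disk//.
rewrite -EFinB.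
by congr EFin; ring.
Qed.

(** * Gaussian mass of a disk *)

Definition gauss (s : R) (x y : R * R) : R :=
  expR (- apsk_sqmod (y.1 - x.1, y.2 - x.2) / s).

Lemma measurable_gauss s (x : R * R) : measurable_fun setT (gauss s x).
Proof.
rewrite /gauss; apply: measurableT_comp; first exact: measurable_expR.
apply: measurable_funM => //; apply: measurableT_comp => //.
exact: measurable_sqmod_sub.
Qed.

(** On an annulus of area [pi * h] the density lies between its values at the squared radii [t + h]
    and [t]. The witness [v] records that the integral is finite. *)
Lemma integral_gauss_annulus s (x : R * R) t h : 0 < s -> 0 <= t -> 0 <= h ->
  exists2 v : R,
    (\int[@apsk_lebC R]_(y in disk x (t + h) `\` disk x t) (gauss s x y)%:E = v%:E)%E &
    pi * h * expR (- (t + h) / s) <= v <= pi * h * expR (- t / s).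
Proof.
move=> s0 t0 h0; set D := _ `\` _.
have mD : measurable D by apply: measurableD; exact: measurable_disk.
have mg : measurable_fun D (fun y => (gauss s x y)%:E).
  by apply/measurable_EFinP; apply: measurable_funTS; exact: measurable_gauss.
have lo : ((pi * h * expR (- (t + h) / s))%:E <=
    \int[@apsk_lebC R]_(y in D) (gauss s x y)%:E)%E.
  rewrite mulrC EFinM -(lebesgue_annulus x t h)// -integral_cst//.
  apply: ge0_le_integral => //= y [yt _]; rewrite lee_fin /gauss ler_expR.
  by rewrite ler_pM2r ?invr_gt0// lerN2.
have hi : (\int[@apsk_lebC R]_(y in D) (gauss s x y)%:E <=
    (pi * h * expR (- t / s))%:E)%E.
  rewrite mulrC EFinM -(lebesgue_annulus x t h)// -integral_cst//.
  apply: ge0_le_integral => //=.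
  - by move=> y _; rewrite lee_fin; exact: expR_ge0.
  move=> y [_ /negP]; rewrite -ltNge => yt; rewrite lee_fin /gauss ler_expR.
  by rewrite ler_pM2r ?invr_gt0// lerN2 ltW.
move: lo hi; case: (integral _ _ _) => [v| |] //; rewrite !lee_fin => lo hi.
by exists v => //; apply/andP.
Qed.

Lemma integral_gauss_diskD s (x : R * R) t h : 0 <= t -> 0 <= h ->
  (\int[@apsk_lebC R]_(y in disk x (t + h)) (gauss s x y)%:E =
   \int[@apsk_lebC R]_(y in disk x t) (gauss s x y)%:E +
   \int[@apsk_lebC R]_(y in disk x (t + h) `\` disk x t) (gauss s x y)%:E)%E.
Proof.
move=> t0 h0.
have sub : disk x t `<=` disk x (t + h) by apply: subset_disk; rewrite lerDl.
rewrite -{1}(setDUK sub) ge0_integral_setU//.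
- exact: measurable_disk.
- by apply: measurableD; exact: measurable_disk.
- by apply/measurable_EFinP; apply: measurable_funTS; exact: measurable_gauss.
- by move=> y _; rewrite lee_fin; exact: expR_ge0.
- by rewrite disj_set2E setDIK.
Qed.

Lemma integral_gauss_disk0 s (x : R * R) :
  (\int[@apsk_lebC R]_(y in disk x 0) (gauss s x y)%:E = 0)%E.
Proof.
apply: null_set_integral.
- exact: measurable_disk.
- by apply/measurable_EFinP; apply: measurable_funTS; exact: measurable_gauss.
- by rewrite [LHS]lebesgue_disk// mulr0.
Qed.

(** The inequality [1 + x <= expR x] at [x = - h / s] and at [x = h / s] gives the two bounds. Up to
    the factor [pi], they are the bounds for the mass of an annulus. *)
Lemma exp_increment_bounds (s t h : R) : 0 < s -> 0 <= h ->
  h * expR (- (t + h) / s) <= s * (expR (- t / s) - expR (- (t + h) / s))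
    <= h * expR (- t / s).
Proof.
move=> s0 h0; set q := expR (- h / s).
have -> : expR (- (t + h) / s) = expR (- t / s) * q.
  by rewrite /q -expRD; congr expR; field; rewrite gt_eqF.
set e := expR (- t / s); have e0 : 0 < e := expR_gt0 _.
have q0 : 0 < q := expR_gt0 _.
have hs : h = s * (h / s) by field; rewrite gt_eqF.
have q1 : 1 - h / s <= q by rewrite /q mulNr; have := expR_ge1Dx (- (h / s)); lra.
have q2 : q * (1 + h / s) <= 1.
  have e1 : q * expR (h / s) = 1 by rewrite /q mulNr expRN mulVf// gt_eqF// expR_gt0.
  by rewrite -[leRHS]e1 ler_pM2l// expR_ge1Dx.
set k := h / s in hs q1 q2; rewrite hs.
(* With [h = s * k], [A] is the lower bound and [B] the upper one, each moved to one side. *)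
have A : 0 <= s * e * (1 - q * (1 + k)) by rewrite mulr_ge0 ?subr_ge0// mulr_ge0// ltW.
have B : 0 <= s * e * (q - (1 - k)) by rewrite mulr_ge0 ?subr_ge0// mulr_ge0// ltW.
by apply/andP; split; lra.
Qed.

(* Both sides grow by an amount between pi h e^(-(t+h)/s) and pi h e^(-t/s) when t is replaced by t + h, so N
   annuli of equal area leave a telescoping error of at most pi t / N. *)
Lemma integral_gauss_disk s (x : R * R) t : 0 < s -> 0 <= t ->
  (\int[@apsk_lebC R]_(y in disk x t) (gauss s x y)%:E =
   (pi * s * (1 - expR (- t / s)))%:E)%E.
Proof.
move=> s0 t0; have pi0 := pi_gt0 R.
pose J u := pi * s * (1 - expR (- u / s)).
have approx h k : 0 <= h -> exists2 v : R,
    (\int[@apsk_lebC R]_(y in disk x (h *+ k)) (gauss s x y)%:E = v%:E)%E &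
    `|v - J (h *+ k)| <= pi * h * (1 - expR (- (h *+ k) / s)).
  move=> h0; elim: k => [|k [v Iv vJ]].
    exists 0; first by rewrite mulr0n integral_gauss_disk0.
    by rewrite mulr0n /J oppr0 mul0r expR0 subrr !mulr0 subrr normr0.
  have kh0 : 0 <= h *+ k by rewrite mulrn_wge0.
  have [w Iw /andP[w1 w2]] := integral_gauss_annulus s x (h *+ k) h s0 kh0 h0.
  exists (v + w); first by rewrite mulrSr integral_gauss_diskD// Iv Iw.
  move: vJ; rewrite mulrSr /J.
  have /andP[] := exp_increment_bounds s (h *+ k) h s0 h0.
  move: w1 w2; set e := expR (- (h *+ k) / s); set e' := expR _ => w1 w2 b1 b2.
  rewrite !ler_norml => /andP[v1 v2].
  (* Both increments lie in an interval of length [pi * h * (e - e')]; adding this to the old error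
     bound [pi * h * (1 - e)] gives [pi * h * (1 - e')]. *)
  have c1 : pi * (h * e') <= pi * (s * (e - e')) by rewrite ler_pM2l.
  have c2 : pi * (s * (e - e')) <= pi * (h * e) by rewrite ler_pM2l.
  by apply/andP; split; lra.
(* One step of size [t] already shows that the integral is a finite number [w]. *)
have [w Iw _] := approx t 1%N t0; rewrite mulr1n in Iw.
rewrite Iw; congr EFin; apply/eqP; rewrite -subr_eq0 -normr_le0 leNgt; apply/negP => d0.
set d := `|_| in d0.
(* [N] exceeds [pi * t / d], so the error bound for [N] annuli falls below the supposed error
   [d]. *)
pose N := (Num.truncn (pi * t / d)).+1.
have N0 : 0 < N%:R :> R by rewrite ltr0n.
have [v Iv] := approx (t / N%:R) N (divr_ge0 t0 (ltW N0)).
have tN : (t / N%:R) *+ N = t by rewrite -mulr_natr divfK// gt_eqF.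
move: Iv; rewrite tN; rewrite Iw => -[<-]; rewrite -/d => dle.
have Nd : pi * t < d * N%:R by rewrite -ltr_pdivrMl// mulrC; exact: truncnS_gt.
have : d <= pi * (t / N%:R).
  have tN0 : 0 <= pi * (t / N%:R) by rewrite mulr_ge0 ?divr_ge0// ltW.
  by apply: (le_trans dle); rewrite ler_piMr.
by rewrite mulrA ler_pdivlMr// leNgt Nd.
Qed.

(** * Integrals of products over the coordinates *)

(** The factor of one symbol in the indicator of the decoding set times the channel density; [s]
    stands for [sigma ^+ 2]. *)
Definition disk_density s (x : R * R) t (y : R * R) : R :=
  \1_(disk x t) y * ((pi * s)^-1 * gauss s x y).

Lemma disk_density_ge0 s (x : R * R) t y : 0 < s -> 0 <= disk_density s x t y.
Proof.
move=> s0; rewrite !mulr_ge0// ?invr_ge0 ?expR_ge0//.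
by rewrite mulr_ge0// ?pi_ge0// ltW.
Qed.

Lemma measurable_disk_density s (x : R * R) t :
  measurable_fun setT (disk_density s x t).
Proof.
rewrite /disk_density; apply: measurable_funM.
  by apply: measurable_indic; exact: measurable_disk.
by apply: measurable_funM => //; exact: measurable_gauss.
Qed.

Lemma integral_disk_density s (x : R * R) t : 0 < s -> 0 <= t ->
  (\int[@apsk_lebC R]_y (disk_density s x t y)%:E = (1 - expR (- t / s))%:E)%E.
Proof.
move=> s0 t0; have pi0 := pi_gt0 R.
transitivity (\int[@apsk_lebC R]_(y in disk x t) ((pi * s)^-1%:E * (gauss s x y)%:E))%E.
  rewrite [RHS]integral_mkcond; apply: eq_integral => y _.
  rewrite patchE /disk_density indicE; case: ifPn => yD.
    by rewrite mul1r EFinM.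
  by rewrite mul0r.
rewrite ge0_integralZl_EFin; last 4 first.
- exact: measurable_disk.
- by move=> y _; rewrite lee_fin; exact: expR_ge0.
- by apply/measurable_EFinP; apply: measurable_funTS; exact: measurable_gauss.
- by rewrite invr_ge0 mulr_ge0// ltW.
rewrite integral_gauss_disk// -EFinM mulKf//.
by rewrite mulf_neq0// gt_eqF.
Qed.

(** Induction on [k]: coordinates below [k] are already integrated out, the others are still read
    from [g]. *)
Lemma apsk_iter_intC_prod (n k : nat) (f : 'I_n -> R * R -> R) (I : 'I_n -> R)
    (g : nat -> R * R) : (k <= n)%N ->
  (forall m y, 0 <= f m y) -> (forall m, measurable_fun setT (f m)) ->
  (forall m, \int[@apsk_lebC R]_y (f m y)%:E = (I m)%:E)%E ->
  apsk_iter_intC k (fun g => (\prod_(m < n) f m (g m))%:E) g =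
  (\prod_(m < n | (m < k)%N) I m * \prod_(m < n | (k <= m)%N) f m (g m))%:E.
Proof.
move=> kn f0 mf fI; elim: k kn g => [_ g|k IH kn g] /=.
  by rewrite big_pred0_eq mul1r.
pose o := Ordinal kn.
have I0 m : 0 <= I m.
  by rewrite -lee_fin -fI; apply: integral_ge0 => y _; rewrite lee_fin.
set P := \prod_(m < n | (m < k)%N) I m.
set Q := \prod_(m < n | (k < m)%N) f m (g m).
(* Only the factor of coordinate [k] depends on [y]; the rest is a nonnegative constant. *)
transitivity (\int[@apsk_lebC R]_y ((P * Q)%:E * (f o y)%:E))%E.
  apply: eq_integral => y _; rewrite IH; last exact: ltnW.
  rewrite -EFinM -mulrA; congr (_ * _)%:E.
  rewrite (bigD1 o)//= eqxx mulrC; congr (_ * _).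
  apply: eq_big => [m|m /andP[_ mo]].
    by rewrite ltn_neqAle andbC eq_sym -val_eqE.
  by rewrite ifN.
rewrite ge0_integralZl_EFin//; last 3 first.
- by move=> y _; rewrite lee_fin.
- by apply/measurable_EFinP; exact: mf.
- by rewrite mulr_ge0// prodr_ge0.
rewrite fI -EFinM mulrAC; congr (_ * _)%:E.
rewrite [RHS](bigD1 o)//= mulrC; congr (_ * _); apply: eq_bigl => m.
by rewrite ltnS ltn_neqAle andbC -val_eqE.
Qed.

Lemma apsk_intCn_prod (n : nat) (f : 'I_n -> R * R -> R) (I : 'I_n -> R) :
  (forall m y, 0 <= f m y) -> (forall m, measurable_fun setT (f m)) ->
  (forall m, \int[@apsk_lebC R]_y (f m y)%:E = (I m)%:E)%E ->
  apsk_intCn (fun y => (\prod_(m < n) f m (y m))%:E) = (\prod_(m < n) I m)%:E.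
Proof.
move=> f0 mf fI; rewrite /apsk_intCn.
rewrite (apsk_iter_intC_prod n n f I)//; congr EFin.
rewrite [X in _ * X]big_pred0 ?mulr1; first by apply: eq_bigl => m; rewrite ltn_ord.
by move=> m; rewrite leqNgt ltn_ord.
Qed.

End disk.
Arguments disk {R}.
Arguments disk_density {R}.

(** * Distinctness of the constellation points *)

Section constellation.
Variables (R : realType) (C : nat) (A : nat -> R) (L : nat -> nat) (alpha : nat -> R).
Hypothesis A_dec : forall c c' : nat, (c < c')%N -> (c' < C)%N -> A c' < A c.
Hypothesis A_pos : forall c : nat, (c < C)%N -> 0 < A c.
Local Notation pt := (apsk_cpoint A L alpha).

Lemma apsk_sqmod_cpoint c l : apsk_sqmod (pt c l) = A c ^+ 2.
Proof. by rewrite /apsk_sqmod/= !exprMn -mulrDr cos2Dsin2 mulr1. Qed.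

(** The squared modulus recovers the amplitude, and the amplitudes strictly decrease. *)
Lemma apsk_cpoint_inj_layer c c' l l' : (c < C)%N -> (c' < C)%N ->
  pt c l = pt c' l' -> c = c'.
Proof.
move=> cC c'C /(congr1 (@apsk_sqmod R)); rewrite !apsk_sqmod_cpoint => /eqP.
rewrite eqrXn2 ?(ltW (A_pos _ _))// => /eqP AA.
by have [/A_dec|/A_dec|//] := ltngtP c c'; rewrite AA ltxx; [move=> /(_ c'C)|move=> /(_ cC)].
Qed.

(** Half the angle between two points with [l < l'] is some [phi] strictly between 0 and [pi], so
    [sin phi > 0]; equal points would force [cos (2 phi) = 1], hence [sin phi = 0]. *)
Lemma apsk_cpoint_inj c l l' : (c < C)%N -> (l < L c)%N -> (l' < L c)%N ->
  pt c l = pt c l' -> l = l'.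
Proof.
move=> cC; wlog lt : l l' / (l < l')%N => [H|] lL l'L ptE.
  have [ll'|l'l|//] := ltngtP l l'; first exact: H.
  by apply/esym; apply: H.
exfalso; have Ac0 := A_pos c cC; have pi0 := pi_gt0 R.
have L0n : (0 < L c)%N by rewrite (leq_ltn_trans _ lL).
have L0 : 0 < (L c)%:R :> R by rewrite ltr0n.
case: ptE => /(mulfI (lt0r_neq0 Ac0)) + /(mulfI (lt0r_neq0 Ac0)).
set th := (X in cos X = _); set th' := (X in _ = cos X) => cE.
rewrite -/th -/th' => sE.
pose phi : R := pi * (l' - l)%:R / (L c)%:R.
have phiE : phi *+ 2 = th' - th.
  by rewrite /phi /th /th' natrB ?(ltnW lt)// -mulr_natl; field; rewrite gt_eqF.
have : cos (phi *+ 2) = 1 by rewrite phiE cosB cE sE -!expr2 cos2Dsin2.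
have s0 : 0 < sin phi.
  apply: sin_gt0_pi; rewrite /phi -mulrA mulr_gt0 ?divr_gt0 ?ltr0n ?subn_gt0//=.
  rewrite -[ltRHS]mulr1 ltr_pM2l// ltr_pdivrMr// mul1r ltr_nat.
  by rewrite (leq_ltn_trans (leq_subr _ _)).
rewrite cos_mulr2n cos2sin2 => e1; have := exprn_gt0 2 s0; lra.
Qed.

(** * Types and layer counts of a codeword *)

Section codeword.
Variables (n : nat) (w : 'I_n -> R * R) (cw lw : 'I_n -> nat).
Hypothesis cwC : forall m, (cw m < C)%N.
Hypothesis lwL : forall m, (lw m < L (cw m))%N.
Hypothesis wE : forall m, w m = pt (cw m) (lw m).

(** As the points are distinct, a symbol of layer [c] matches exactly one point of that layer, and
    any other symbol matches none. *)
Lemma sum_apsk_wtype_layer c : (0 < n)%N -> (c < C)%N ->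
  n%:R * \sum_(l < L c) apsk_wtype w (pt c l) = \sum_(m < n) (cw m == c)%:R.
Proof.
move=> n0 cC; rewrite /apsk_wtype -mulr_sumr mulVKf ?pnatr_eq0 -?lt0n//.
rewrite exchange_big/=; apply: eq_bigr => m _.
have [cE|cN] := eqVneq (cw m) c; last first.
  rewrite big1// => l _; case: eqP => // wl.
  by case/eqP: cN; apply: (@apsk_cpoint_inj_layer _ _ (lw m) l) => //; rewrite -wE.
have lL : (lw m < L c)%N by rewrite -cE.
rewrite (bigD1 (Ordinal lL))//= wE cE eqxx big1 ?addr0// => l ll.
case: eqP => // /apsk_cpoint_inj lE; case/eqP: ll; apply/val_inj => /=.
by rewrite lE.
Qed.

Lemma sum_layer (f : nat -> R) :
  \sum_(c < C) (\sum_(m < n) (cw m == c)%:R) * f c = \sum_(m < n) f (cw m).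
Proof.
under eq_bigr do rewrite mulr_suml.
rewrite exchange_big/=; apply: eq_bigr => m _.
rewrite (bigD1 (Ordinal (cwC m)))//= eqxx mul1r big1 ?addr0// => c cN.
by rewrite (_ : _ == _ = false) ?mul0r//; apply: contraNF cN; rewrite eq_sym -val_eqE.
Qed.

(** The exponent is a count, so for a nonnegative base [powR] is an ordinary power, and each symbol
    contributes the factor of its layer. *)
Lemma prod_layer (q : nat -> R) : (forall c, (c < C)%N -> 0 <= q c) ->
  \prod_(c < C) powR (q c) (\sum_(m < n) (cw m == c)%:R) = \prod_(m < n) q (cw m).
Proof.
move=> q0; transitivity (\prod_(c < C) \prod_(m < n) q c ^+ (cw m == c)).
  by apply: eq_bigr => c _; rewrite -natr_sum powR_mulrn ?q0// prodrXr.
rewrite exchange_big/=; apply: eq_bigr => m _.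
rewrite (bigD1 (Ordinal (cwC m)))//= eqxx expr1 big1 ?mulr1// => c cN.
by rewrite (_ : _ == _ = false) ?expr0//; apply: contraNF cN; rewrite eq_sym -val_eqE.
Qed.

Lemma apsk_energy_wtype (k1 k2 : R) : (0 < n)%N ->
  apsk_energy k1 k2 w = n%:R * \sum_(c < C) \sum_(l < L c)
    apsk_wtype w (pt c l) * (k1 * A c ^+ 2 + k2 * A c ^+ 4).
Proof.
move=> n0; rewrite /apsk_energy !mulr_sumr -big_split/=.
under [RHS]eq_bigr => c _ do rewrite -mulr_suml mulrA sum_apsk_wtype_layer//.
rewrite (sum_layer (fun c => k1 * A c ^+ 2 + k2 * A c ^+ 4)).
by apply: eq_bigr => m _; rewrite wE apsk_sqmod_cpoint -exprM.
Qed.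

(** * Success probability of a codeword *)

Variables (sigma : R) (r : nat -> R).
Hypothesis r_pos : forall c, (c < C)%N -> 0 < r c.

(** [apsk_dec_set] quantifies over all pairs [c], [l] naming a symbol; since the symbol determines
    its layer, only one radius occurs for each coordinate. *)
Lemma apsk_dec_setE (y : 'I_n -> R * R) :
  \1_(apsk_dec_set C A L alpha r w) y =
  \prod_(m < n) \1_(disk (w m) (r (cw m) ^+ 2)) (y m) :> R.
Proof.
have diskE m : (apsk_cdist (y m) (w m) <= r (cw m)) = (y m \in disk (w m) (r (cw m) ^+ 2)).
  have rm := r_pos _ (cwC m).
  rewrite /apsk_cdist -[r (cw m) in LHS]gtr0_norm// -sqrtr_sqr ler_sqrt ?sqr_ge0//.
  by apply/idP/idP; rewrite inE.
rewrite indicE; have [yD|yD] := boolP (y \in _).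
  rewrite big1// => m _; rewrite indicE -diskE.
  by move: yD; rewrite inE => /(_ m _ _ (cwC m) (lwL m) (wE m)); rewrite -wE => ->.
have [m] : exists m, y m \notin disk (w m) (r (cw m) ^+ 2).
  apply/existsP; apply: contraNT yD => /existsPn yD; rewrite inE => m c l cC lL wl.
  have cE : cw m = c by apply: (@apsk_cpoint_inj_layer _ _ (lw m) l) => //; rewrite -wE.
  by have := yD m; rewrite negbK -diskE cE -wl.
by move=> /negPf ym; rewrite (bigD1 m)//= indicE ym mul0r.
Qed.

Lemma apsk_success_prob : 0 < sigma ->
  apsk_intCn (fun y => (\1_(apsk_dec_set C A L alpha r w) y *
                        apsk_awgn_density sigma w y)%:E) =
  (\prod_(m < n) (1 - expR (- (r (cw m) ^+ 2) / sigma ^+ 2)))%:E.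
Proof.
move=> s0; have s20 : 0 < sigma ^+ 2 by rewrite exprn_gt0.
rewrite -(@apsk_intCn_prod _ n (fun m => disk_density (sigma ^+ 2) (w m) (r (cw m) ^+ 2))).
- congr apsk_intCn; apply/funext => y; congr EFin.
  by rewrite apsk_dec_setE -big_split.
- by move=> m y; exact: disk_density_ge0.
- by move=> m; exact: measurable_disk_density.
- by move=> m; apply: integral_disk_density => //; exact: sqr_ge0.
Qed.

End codeword.
End constellation.

(** * Error probability and energy fraction of the code *)

Theorem theorem3 (R : realType)
  (* channel and cost parameters *)
  (sigma k1 k2 : R) (hsigma : 0 < sigma) (hk1 : 0 < k1) (hk2 : 0 < k2)
  (* code parameters *)
  (n M : nat) (hn : (0 < n)%N) (hM : (0 < M)%N)
  (eps B delta : R)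
  (* family C(C, A, L, alpha, p, r); layers indexed 0 .. C-1 *)
  (C : nat) (hC : (0 < C)%N)
  (A : nat -> R) (L : nat -> nat) (alpha : nat -> R) (p : nat -> R) (r : nat -> R)
  (hA_dec : forall c c' : nat, (c < c')%N -> (c' < C)%N -> A c' < A c)
  (hA_pos : forall c : nat, (c < C)%N -> 0 < A c)
  (hL : forall c : nat, (c < C)%N -> (0 < L c)%N)
  (halpha : forall c : nat, (c < C)%N -> 0 <= alpha c <= 2 * pi)
  (hp_nonneg : forall c : nat, (c < C)%N -> 0 <= p c)
  (hp_sum : \sum_(c < C) p c = 1)
  (hr : forall c : nat, (c < C)%N -> 0 < r c)
  (hsep : forall c : nat, (c.+1 < C)%N -> A c - A c.+1 >= r c + r c.+1)
  (* the codewords *)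
  (u : 'I_M -> 'I_n -> R * R)
  (hu_X : forall (i : 'I_M) (m : 'I_n), apsk_in_constellation C A L alpha (u i m))
  (hu_inj : injective u)
  (hu_type : forall c l : nat, (c < C)%N -> (l < L c)%N ->
     apsk_code_type u (apsk_cpoint A L alpha c l) = p c / (L c)%:R)
  (* (u(i), D_i) is an (n, M, X)-code: decoding sets pairwise disjoint *)
  (hD_disj : forall i j : 'I_M, i != j ->
     apsk_dec_set C A L alpha r (u i) `&` apsk_dec_set C A L alpha r (u j) = set0)
  (* the four inequalities *)
  (h_eps : eps >= 1 - M%:R^-1 * \sum_(i < M) \prod_(c < C)
      powR (1 - expR (- (r c ^+ 2) / sigma ^+ 2))
           (n%:R * \sum_(l < L c) apsk_wtype (u i) (apsk_cpoint A L alpha c l)))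
  (h_rate : apsk_log2 (M%:R : R) / n%:R <=
      apsk_log2 (\sum_(c < C) (Num.floor (pi / (2 * asin (r c / (2 * A c)))))%:~R))
  (h_delta : delta >= M%:R^-1 * \sum_(i < M)
      (\sum_(c < C) \sum_(l < L c)
          apsk_wtype (u i) (apsk_cpoint A L alpha c l) * (k1 * A c ^+ 2 + k2 * A c ^+ 4)
        < B / n%:R)%R%:R)
  (h_B : let ebar := sort <=%R (undup [seq apsk_energy k1 k2 (u i) | i <- enum 'I_M]) in
         let cond := fun j : nat => delta <= M%:R^-1 *
               \sum_(k < j.+1) \sum_(i < M) (apsk_energy k1 k2 (u i) == nth 0 ebar k)%R%:R in
         exists jplus : nat, [/\ (jplus < size ebar)%N, cond jplus,
             (forall j : nat, (j < jplus)%N -> ~ cond j)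
           & B <= nth 0 ebar jplus]) :
  (apsk_err_prob sigma u (fun i => apsk_dec_set C A L alpha r (u i)) <= eps%:E)%E /\
  apsk_theta k1 k2 u B <= delta.
Proof.
have layer i : exists cl : ('I_n -> nat) * ('I_n -> nat),
    [/\ forall m, (cl.1 m < C)%N, forall m, (cl.2 m < L (cl.1 m))%N &
        forall m, u i m = apsk_cpoint A L alpha (cl.1 m) (cl.2 m)].
  have /choice[cw cwP] := hu_X i; have /choice[lw lwP] := cwP.
  by exists (cw, lw); split => m /=; have [? []] := lwP m.
have n0 : 0 < n%:R :> R by rewrite ltr0n.
have M0 : M%:R != 0 :> R by rewrite pnatr_eq0 -lt0n.
split; last first.
  (* The two indicator sums agree term by term: the energy is [n] times the type sum, and dividing
     by [n] preserves the strict inequality. *)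
  apply: le_trans h_delta; rewrite le_eqVlt; apply/orP; left; apply/eqP.
  rewrite /apsk_theta; congr (_ * _); apply: eq_bigr => i _; congr (_%:R).
  have [[cw lw] /= [cwC lwL wE]] := layer i.
  rewrite (@apsk_energy_wtype _ _ _ _ _ hA_dec hA_pos _ _ _ _ cwC lwL wE)//.
  by rewrite ltr_pdivlMr// mulrC.
rewrite /apsk_err_prob.
pose P (i : 'I_M) : R := \prod_(c < C)
  powR (1 - expR (- (r c ^+ 2) / sigma ^+ 2))
       (n%:R * \sum_(l < L c) apsk_wtype (u i) (apsk_cpoint A L alpha c l)).
have succ i : apsk_intCn (fun y => (\1_(apsk_dec_set C A L alpha r (u i)) y *
    apsk_awgn_density sigma (u i) y)%:E) = (P i)%:E.
  have [[cw lw] /= [cwC lwL wE]] := layer i.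
  rewrite (@apsk_success_prob _ _ _ _ _ hA_dec hA_pos _ _ _ _ cwC lwL wE)//.
  rewrite /P; congr EFin.
  rewrite -(@prod_layer _ _ _ _ cwC (fun c => 1 - expR (- (r c ^+ 2) / sigma ^+ 2))).
    apply: eq_bigr => c _; congr powR.
    by rewrite (@sum_apsk_wtype_layer _ _ _ _ _ hA_dec hA_pos _ _ _ _ cwC lwL wE).
  move=> c _; rewrite subr_ge0 -expR0 ler_expR mulNr oppr_le0.
  by rewrite divr_ge0// sqr_ge0.
under eq_bigr do rewrite succ -EFinB.
(* All success probabilities are finite, so the average splits over the reals; the constant 1
   averages to 1, which leaves [h_eps]. *)
rewrite sumEFin -EFinM lee_fin sumrB mulrBr.
by rewrite sumr_const card_ord mulVf.
Qed.
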